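(* Every equicontinuous flow is strongly rigid and every strongly rigid flow is distal, and both inclusions of classes are strict: there exists a strongly rigid flow that is not equicontinuous, and there exists a distal flow that is not strongly rigid. That is, $\{\text{equicontinuous flows}\}\subsetneq\{\text{strongly rigid flows}\}\subsetneq\{\text{distal flows}\}$.
   Context: A flow $(X,T)$ is an action $(t,x)\mapsto tx$ of an infinite discrete (not necessarily abelian) group $T$ by homeomorphisms on a compact, infinite metric space $(X,d)$; each $t\in T$ is identified with the map $x\mapsto tx$, and $e\in T$ is the identity. The enveloping semigroup $E(X)$ is the closure of $T$ in $X^X$ with the product (point-open) topology; it is a semigroup under composition. A nonempty $I\subset E(X)$ is a left ideal if $E(X)\cdot I\subset I$; a minimal ideal is a closed left ideal containing no left ideal as a proper subset. A minimal idempotent is an idempotent belonging to a minimal ideal. The flow is strongly rigid if every minimal idempotent $u\in E(X)$ is an accumulation point in $E(X)$ endowed with the compact-open topology, i.e. there is a (non-trivial) net $\{t_k\}$ in $T$ with $t_k\to u$ uniformly on $X$; non-trivial means $t_k\neq u$ for all $k$, and in particular, when $u=e$, no $t_k$ is the identity element of $T$. The flow is equicontinuous if for every $y\in X$ and $\epsilon>0$ there is a neighborhood $U$ of $y$ with $d(tx,ty)<\epsilon$ for all $x\in U$, $t\in T$. Points $x,y$ are proximal if the orbit closure of $(x,y)$ in $(X\times X,T)$ meets the diagonal; the flow is distal if no two distinct points are proximal. *)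

(* Defs.v *)
From HB Require Import structures.
From mathcomp Require Import all_boot all_order all_algebra.
From mathcomp Require Import all_classical all_reals all_analysis.

Set Implicit Arguments.
Unset Strict Implicit.
Unset Printing Implicit Defensive.

Import Order.TTheory GRing.Theory Num.Theory.
Local Open Scope classical_set_scope.
Local Open Scope ring_scope.

(* [groupType] is the library's possibly infinite, possibly nonabelian group,
   in multiplicative notation.  The action is not required to be effective:
   see [nontrivial_for]. *)
Record flow (R : realType) := Flow {
  phase : metricType R ;
  grp : groupType ;
  act : grp -> phase -> phase ;
  phase_compact : compact [set: phase] ;
  phase_infinite : infinite_set [set: phase] ;
  grp_infinite : infinite_set [set: grp] ;
  act1 : forall x, act 1%g x = x ;
  actM : forall s t x, act (s * t)%g x = act s (act t x) ;
  (* together with [act1] and [actM], each [act t] is a homeomorphism *)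
  act_continuous : forall t, continuous (act t)
}.

Section FlowDefs.
Context {R : realType} (F : flow R).
Let X : Type := phase F.
Let T : Type := grp F.

Definition effective : Prop :=
  forall t : grp F, (forall x, act t x = x) -> t = 1%g.

(* [{ptws X -> X}] is X^X with the product topology. *)
Definition enveloping_semigroup : set (X -> X) :=
  closure (range (@act R F) : set {ptws phase F -> phase F}).

Definition left_ideal (I : set (X -> X)) : Prop :=
  [/\ I `<=` enveloping_semigroup,
      I !=set0 &
      forall p q, enveloping_semigroup p -> I q -> I (p \o q)].

(* Since E(X) is closed in X^X, closed in E(X) amounts to closed in X^X. *)
Definition minimal_ideal (I : set (X -> X)) : Prop :=
  [/\ left_ideal I,
      closed (I : set {ptws phase F -> phase F}) &
      forall J : set (X -> X), left_ideal J -> J `<=` I -> J = I].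

Definition minimal_idempotent (u : X -> X) : Prop :=
  u \o u = u /\ exists2 I, minimal_ideal I & I u.

(* "t differs from u", for t in T and u in E(X): as maps in general, and as
   elements of T when u is the identity.  For effective flows this is just
   [act t <> u].  With [act t <> u] throughout, a trivial action of an infinite
   group would be equicontinuous but not strongly rigid. *)
Definition nontrivial_for (u : X -> X) (t : grp F) : Prop :=
  (u <> id -> act t <> u) /\ (u = id -> t <> 1%g).

Definition directed (K : Type) (le : K -> K -> Prop) : Prop :=
  [/\ inhabited K,
      forall i, le i i,
      forall i j k, le i j -> le j k -> le i k &
      forall i j, exists k, le i k /\ le j k].

Definition net_cvg_uniform (K : Type) (le : K -> K -> Prop)
    (t : K -> T) (u : X -> X) : Prop :=
  forall e : R, 0 < e -> exists k0, forall k, le k0 k ->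
    forall x : phase F, mdist (act (t k) x) (u x) < e.

Definition strongly_rigid : Prop :=
  forall u, minimal_idempotent u ->
    exists (K : Type) (le : K -> K -> Prop) (t : K -> T),
      [/\ directed le,
          forall k, nontrivial_for u (t k) &
          net_cvg_uniform le t u].

Definition equicontinuous_flow : Prop :=
  forall (y : phase F) (e : R), 0 < e ->
    exists2 U, nbhs y U &
      forall x, U x -> forall t : grp F, mdist (act t x) (act t y) < e.

Definition orbit_closure2 (x y : phase F) : set (phase F * phase F) :=
  closure (range (fun t : grp F => (act t x, act t y))).

Definition proximal (x y : phase F) : Prop :=
  orbit_closure2 x y `&` [set z | z.1 = z.2] !=set0.

Definition distal : Prop := forall x y : phase F, x <> y -> ~ proximal x y.

End FlowDefs.

(* Main.v *)
Require Import Defs.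
From HB Require Import structures.
From mathcomp Require Import all_boot all_order all_algebra.
From mathcomp Require Import all_classical all_reals all_analysis.
From mathcomp Require Import finmap lra zify.

(** Everything rests on one criterion ([strongly_rigidP]): a flow is strongly
    rigid exactly when it is distal and, for every [e > 0], some [t <> 1] moves
    every point by less than [e].

    For the criterion, [E(X)] is compact and composition is continuous in its
    left factor, so Zorn's lemma yields a minimal ideal, and in it an
    idempotent ([exists_minimal_idempotent]).  In a distal flow every idempotent
    [u] of [E(X)] is the identity, because [x] and [u x] are proximal; so strong
    rigidity only asks for elements of the group near the identity.  Conversely,
    let [u] be a minimal idempotent that is a uniform limit of homeomorphisms.
    It is continuous with dense range, and it fixes its range, so it is the
    identity ([strongly_rigid_minimal_id]).  Then [E(X)] itself is a minimal
    ideal, so all its elements are left invertible and distinct points are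
    never proximal ([minimal_id_distal]).

    Equicontinuity implies distality, and a pigeonhole argument on a finite
    cover by sets on which all maps of the action vary little gives distinct [s]
    and [t] for which [s^-1 t] is uniformly near the identity
    ([equicontinuous_recurrent]).

    Both counterexamples consist of countably many two-point blocks accumulating
    at two fixed points, acted on by the group of finitely supported swaps
    inside blocks.  Orbits have at most two points, so the flow is distal.  Only
    the diameters of the blocks matter.  Infinitely many blocks of diameter at
    least 1 destroy equicontinuity, since swaps then move points arbitrarily
    near a fixed point by at least 1; blocks of arbitrarily small diameter
    provide swaps near the identity.  With infinitely many blocks of both kinds
    the flow is strongly rigid and not equicontinuous; if every block has
    diameter at least 1, a nontrivial element moves some point by at least 1,
    and the flow is not strongly rigid. *)

Set Implicit Arguments.
Unset Strict Implicit.
Unset Printing Implicit Defensive.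

Import Order.TTheory GRing.Theory Num.Theory.
Local Open Scope classical_set_scope.
Local Open Scope ring_scope.

(** * Topological preliminaries *)

(** Zorn's lemma applied to complements.  [Q] is any property stable under
    intersections, such as being a left ideal or a subsemigroup, and
    compactness keeps the intersection of a chain nonempty. *)
Lemma minimal_closed (Z : topologicalType) (K : set Z) (Q : set (set Z)) :
  compact K -> closed K -> K !=set0 -> Q K ->
  (forall C : set (set Z), C `<=` Q -> Q (\bigcap_(A in C) A)) ->
  exists A, [/\ closed A, A !=set0, A `<=` K, Q A &
    forall B, closed B -> B !=set0 -> B `<=` A -> Q B -> B = A].
Proof.
move=> Kcpt Kcl K0 QK Qcap.
(* The containment in [K] is left out of [P]: the complement of the empty union
   is the whole space, which need not lie in [K]. *)
pose P B := [/\ closed (~` B), K `&` ~` B !=set0 & Q (~` B)].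
have [|M [[Mcl M0 QM] Mmax]] := @Zorn_bigcup Z P.
  move=> F FP Ftot; rewrite /P setC_bigcup; split.
  - by apply: closed_bigI => B /FP[].
  - have [[B0 FB0]|F0] := pselect (F !=set0); last first.
      have [x Kx] := K0; exists x; split=> // B FB.
      by exfalso; apply: F0; exists B.
    have FF : ProperFilter (filter_from F (fun B => K `&` ~` B)).
      apply: filter_from_proper; last by move=> B /FP[].
      apply: filter_from_filter; first by exists B0.
      move=> A B FA FB; have [AB|BA] := Ftot _ _ FA FB.
        by exists B => // x [Kx nBx]; split; split=> // /AB.
      by exists A => // x [Kx nAx]; split; split=> // /BA.
    have [|x [Kx clx]] := Kcpt _ FF; first by exists B0 => // x [].
    exists x; split=> // B FB; have [Bcl _ _] := FP _ FB.
    apply: Bcl => U xU; apply: clx xU.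
    by exists B => // y [].
  - rewrite -(bigcap_image F (fun B => ~` B) id).
    by apply: Qcap => _ [B FB <-]; have [] := FP _ FB.
have KMK : K `&` ~` M `<=` K by move=> x [].
exists (K `&` ~` M); split => //.
- exact: closedI.
- have := Qcap [set K; ~` M]; rewrite bigcap_setU !bigcap_set1; apply.
  by move=> A [->|->].
move=> B Bcl [b Bb] BKM QB; apply/seteqP; split => // x [Kx nMx].
apply: contrapT => nBx; apply: (Mmax (~` B)); last first.
  by rewrite /P setCK; split=> //; exists b; split => //; case: (BKM _ Bb).
split; first by move=> y My /BKM[].
by move=> /(_ x nBx) /nMx.
Qed.

Lemma ptws_continuous (T : topologicalType) (U : eqType) (V : topologicalType)
    (f : T -> {ptws U -> V}) :
  (forall x, continuous (fun t => f t x)) -> continuous f.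
Proof.
move=> fcts t; apply/cvg_sup => x; move: t.
apply/(@continuousP _ (initial_topology (fun g : U -> V => g x))).
move=> A [B oB <-]; rewrite -comp_preimage.
by apply: open_comp => // s _; exact: fcts.
Qed.

Lemma hausdorff_prod (T U : topologicalType) :
  hausdorff_space T -> hausdorff_space U -> hausdorff_space (T * U)%type.
Proof.
move=> hT hU [a b] [c d] cl; congr pair.
- apply: hT => A B aA cB.
  have [||[x y] [/= ? ?]] := cl (fst @^-1` A) (fst @^-1` B).
  + exact: (@cvg_fst _ _ (nbhs a) (nbhs b)).
  + exact: (@cvg_fst _ _ (nbhs c) (nbhs d)).
  by exists x.
- apply: hU => A B bA dB.
  have [||[x y] [/= ? ?]] := cl (snd @^-1` A) (snd @^-1` B).
  + exact: (@cvg_snd _ _ (nbhs a) (nbhs b)).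
  + exact: (@cvg_snd _ _ (nbhs c) (nbhs d)).
  by exists y.
Qed.

Lemma closure_continuous_sub (T U : topologicalType) (f : T -> U) (A : set T)
    (C : set U) : continuous f -> closed C -> (forall x, A x -> C (f x)) ->
  forall x, closure A x -> C (f x).
Proof.
move=> fcts Ccl AC x Ax; have := (continuous_closedP f).1 fcts _ Ccl; apply.
exact: closureS Ax.
Qed.

Lemma pigeonhole (T : Type) (J : finType) (f : T -> J) :
  infinite_set [set: T] -> exists s t, s <> t /\ f s = f t.
Proof.
move=> Tinf; apply: contrapT => nst; apply: Tinf.
have finj : injective f.
  by move=> s t fst; apply: contrapT => st; apply: nst; exists s, t.
rewrite -(preimage_setT f); apply: finite_preimage => //.
by move=> s t _ _; exact: finj.
Qed.

(** * The enveloping semigroup *)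

Section FlowTheory.
Context {R : realType} (F : flow R).
Local Notation X := (phase F).
Local Notation XX := {ptws X -> X}.
Local Notation E := (@enveloping_semigroup R F).
Implicit Types (x y z : X) (p q u : X -> X) (s t : grp F).

Lemma actK t : cancel (act t) (@act R F t^-1%g).
Proof. by move=> x; rewrite -actM mulVg act1. Qed.

Lemma actKV t : cancel (@act R F t^-1%g) (act t).
Proof. by move=> x; rewrite -actM mulgV act1. Qed.

Lemma phase_nonempty : exists x : X, True.
Proof.
have [x _] := infinite_setN0 (@phase_infinite R F).
by exists x.
Qed.

Lemma ptws_hausdorff : hausdorff_space XX.
Proof. by apply: hausdorff_product => _; exact: metric_hausdorff. Qed.

Lemma ptws_eval_continuous x : continuous (fun p : XX => p x).
Proof. exact: (@proj_continuous _ (fun=> X) x). Qed.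

Lemma comp_right_continuous q : continuous (fun p : XX => (p \o q : XX)).
Proof. by apply: ptws_continuous => x; exact: ptws_eval_continuous. Qed.

Lemma act_comp_continuous t : continuous (fun p : XX => (act t \o p : XX)).
Proof.
apply: ptws_continuous => x p /=.
apply: (@continuous_comp _ _ _ (fun p : XX => p x) (act t)).
  exact: ptws_eval_continuous.
exact: act_continuous.
Qed.

Lemma enveloping_closed : closed (E : set XX).
Proof. exact: closed_closure. Qed.

Lemma enveloping_compact : compact (E : set XX).
Proof.
apply: (@subclosed_compact XX E setT) => //; first exact: enveloping_closed.
rewrite (_ : setT = [set f : XX | forall x, [set: X] (f x)]); last first.
  by apply/seteqP; split.
exact: (@tychonoff _ (fun=> X) (fun=> setT) (fun=> @phase_compact R F)).
Qed.

Lemma enveloping_act t : E (act t).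
Proof. by apply: subset_closure; exists t. Qed.

Lemma enveloping_id : E id.
Proof.
by have := @enveloping_act 1%g; congr E; apply/funext => x; rewrite act1.
Qed.

(** Composition is always continuous in its left factor, but in its right factor
    only when the left one is continuous.  So the closure is taken in two
    stages: in the right factor while the left one comes from the group, and
    then in the left factor. *)
Lemma enveloping_comp p q : E p -> E q -> E (p \o q).
Proof.
move=> Ep Eq.
apply: (@closure_continuous_sub XX XX (fun p => p \o q)) Ep.
- exact: comp_right_continuous.
- exact: enveloping_closed.
move=> _ [t _ <-].
apply: (@closure_continuous_sub XX XX (fun p => act t \o p)) Eq.
- exact: act_comp_continuous.
- exact: enveloping_closed.
move=> _ [s _ <-].
rewrite (_ : _ \o _ = act (t * s)%g); first exact: enveloping_act.
by apply/funext => x /=; rewrite actM.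
Qed.

(** The right-hand side is the image of a compact set, hence closed. *)
Lemma orbit_closure2E x y :
  orbit_closure2 x y = (fun p => (p x, p y)) @` E.
Proof.
have cts : continuous (fun p : XX => (p x, p y)).
  move=> p; apply: (@cvg_pair _ _ _ (nbhs p) (nbhs (p x)) (nbhs (p y))).
    exact: (@ptws_eval_continuous x p).
  exact: (@ptws_eval_continuous y p).
apply/seteqP; split.
  have clI : closed ((fun p : XX => (p x, p y)) @` E).
    apply: compact_closed.
      by apply: hausdorff_prod; exact: metric_hausdorff.
    apply: (@continuous_compact XX); last exact: enveloping_compact.
    exact: continuous_subspaceT.
  move=> z xyz; apply: clI; apply: closureS xyz => _ [t _ <-].
  by exists (act t) => //; exact: enveloping_act.
move=> _ [p Ep <-].
apply: (closure_continuous_sub cts) Ep; first exact: closed_closure.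
by move=> _ [t _ <-]; apply: subset_closure; exists t.
Qed.

Lemma proximalP x y : proximal x y <-> exists2 p, E p & p x = p y.
Proof.
rewrite /proximal orbit_closure2E; split.
  by move=> [_ [[p Ep <-] /= pxy]]; exists p.
by move=> [p Ep pxy]; exists (p x, p y); split=> //; exists p.
Qed.

(** The image of a compact set in a Hausdorff space. *)
Lemma right_translate_closed q (A : set (X -> X)) : A `<=` E ->
  closed (A : set XX) -> closed ((fun p => p \o q) @` A : set XX).
Proof.
move=> AE Acl; apply: compact_closed; first exact: ptws_hausdorff.
apply: (@continuous_compact XX XX (fun p => p \o q)).
  by apply: continuous_subspaceT; exact: comp_right_continuous.
exact: subclosed_compact enveloping_compact AE.
Qed.

(** A closed left ideal that is minimal among closed ones is minimal among all
    left ideals: any left ideal contains some [E(X) q], which is closed. *)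
Lemma exists_minimal_ideal : exists I, @minimal_ideal R F I.
Proof.
pose Q := [set A : set (X -> X) | forall p q, E p -> A q -> A (p \o q)].
have [||||A [Acl A0 AE QA Amin]] := @minimal_closed XX E Q enveloping_compact.
- exact: enveloping_closed.
- by exists id; exact: enveloping_id.
- by move=> p q; exact: enveloping_comp.
- by move=> C CQ p q Ep Cq A CA; apply: CQ => //; exact: Cq.
exists A; split; [by split|by []|move=> J [JE [q Jq] QJ] JA].
have EqJ : (fun p => p \o q) @` E `<=` J by move=> _ [p Ep <-]; exact: QJ.
apply/seteqP; split => // p Ap; apply: (EqJ).
suff -> : (fun p => p \o q) @` E = A by [].
apply: Amin.
- by apply: right_translate_closed => //; exact: enveloping_closed.
- by exists q; exists id => //; exact: enveloping_id.
- by move=> f /EqJ /JA.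
- move=> f _ Ef [g Eg <-]; exists (f \o g) => //; exact: enveloping_comp.
Qed.

(** The argument of Ellis and Numakura.  If [S] is a minimal closed subsemigroup
    of a minimal ideal and [u] is in [S], then [S u = S]; so
    [{p in S | p u = u}] is a nonempty closed subsemigroup, hence all of [S]. *)
Lemma exists_minimal_idempotent : exists u, @minimal_idempotent R F u.
Proof.
have [I Imin] := exists_minimal_ideal.
have [[IE I0 QI] Icl _] := Imin.
have Icpt : compact (I : set XX).
  exact: subclosed_compact enveloping_compact IE.
pose Q := [set A : set (X -> X) | forall p q, A p -> A q -> A (p \o q)].
have [||S [Scl [u Su] SI QS Smin]] := @minimal_closed XX I Q Icpt Icl I0.
- by move=> p q Ip Iq; apply: QI => //; exact: IE.
- by move=> C CQ p q Cp Cq A CA; apply: (CQ _ CA); [exact: Cp|exact: Cq].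
have SE : S `<=` E by move=> p /SI /IE.
have SuS : (fun p => p \o u) @` S `<=` S by move=> _ [p Sp <-]; exact: QS.
have SuE : (fun p => p \o u) @` S = S.
  apply: Smin => //; first exact: right_translate_closed.
    by exists (u \o u); exists u.
  move=> _ _ [p Sp <-] [q Sq <-]; exists (p \o u \o q) => //.
  by apply: (QS) => //; exact: QS.
exists u; split; last by exists I => //; exact: SI.
have [v Sv vu] : ((fun p => p \o u) @` S) u by rewrite SuE.
pose W : set (X -> X) := [set p : X -> X | p \o u = u].
have Wcl : closed (W : set XX).
  apply: (continuous_closedP (fun p : XX => p \o u : XX)).1 [set u] _.
    exact: comp_right_continuous.
  by apply: accessible_closed_set1; apply: hausdorff_accessible;
     exact: ptws_hausdorff.
suff : (S `&` W) u by case.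
rewrite (_ : _ `&` _ = S) //; apply: Smin.
- exact: closedI.
- by exists v.
- by move=> p [].
- move=> p q [Sp pu] [Sq qu]; split; first exact: QS.
  exact: etrans (congr1 (fun r => p \o r) qu) pu.
Qed.

(** [u x = u (u x)], so [x] and [u x] are proximal. *)
Lemma distal_idempotent u : distal F -> E u -> u \o u = u -> u = id.
Proof.
move=> dF Eu uu; apply/funext => x; apply: contrapT => uxx.
apply: (dF _ _ uxx); apply/proximalP; exists u => //.
by have := congr1 (fun f => f x) uu.
Qed.

(** An ideal containing the identity is [E(X)].  If [p x = p y], the left
    ideal [E(X) p] equals [E(X)] by minimality, so [p] has a left inverse and
    [x = y]. *)
Lemma minimal_id_distal : @minimal_idempotent R F id -> distal F.
Proof.
move=> [_ [I [[IE I0 QI] Icl Imin] Iid]] x y xy /proximalP[p Ep pxy].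
have EI : E `<=` I by move=> q Eq; exact: (QI _ _ Eq Iid).
have EpE : (fun q => q \o p) @` E `<=` E.
  by move=> _ [q Eq <-]; exact: enveloping_comp.
have EpI : (fun q => q \o p) @` E = I.
  apply: Imin; last by move=> q /EpE /EI.
  split => //; first by exists p; exists id => //; exact: enveloping_id.
  by move=> f _ Ef [g Eg <-]; exists (f \o g) => //; exact: enveloping_comp.
have [q Eq qp] : ((fun q => q \o p) @` E) id by rewrite EpI.
apply: xy; have := congr1 (fun f => f x) qp; have := congr1 (fun f => f y) qp.
by rewrite /= pxy => ->.
Qed.

Lemma distal_minimal_id u :
  distal F -> @minimal_idempotent R F u -> u = id.
Proof.
move=> dF [uu [I [[IE _ _] _ _] Iu]].
by apply: distal_idempotent => //; exact: IE.
Qed.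

(** * The criterion for strong rigidity *)

Lemma mdist_small x y : (forall e, 0 < e -> mdist x y < e) -> x = y.
Proof.
move=> small; apply: mdist_positivity; apply/eqP.
rewrite eq_le mdist_ge0 andbT; apply/ler_addgt0Pr => e e0.
by rewrite add0r ltW // small.
Qed.

Lemma act_mdist_continuous t x e : 0 < e ->
  exists2 d, 0 < d & forall y, mdist x y < d -> mdist (act t x) (act t y) < e.
Proof.
move=> e0; have := @act_continuous R F t x _ (nbhsx_ballx _ _ e0).
move=> /nbhs_ballP[d /= d0 sub]; exists d => // y xy.
by have := sub y; rewrite /= !ballEmdist; apply.
Qed.

(** A uniform limit [u] of homeomorphisms is continuous and has dense range; a
    continuous idempotent with dense range is the identity.  The proof does
    this with explicit tolerances: [w = u (r^-1 y)] is a fixed point of [u]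
    close to [y], where the element [r] of the group is close to [u]. *)
Lemma strongly_rigid_minimal_id u :
  strongly_rigid F -> @minimal_idempotent R F u -> u = id.
Proof.
move=> sF mu; have [uu _] := mu.
have [K [le [t [[_ lexx _ _] _ tu]]]] := sF u mu.
have {lexx}tu e :
    0 < e -> exists s : grp F, forall x, mdist (act s x) (u x) < e.
  by move=> /tu[k0 /(_ _ (lexx k0))]; exists (t k0).
apply/funext => y; apply: mdist_small => e e0.
have e40 : 0 < e / 4 by rewrite divr_gt0.
(* [s] is chosen first: closeness of [w] to [y] is measured by the modulus of
   continuity of [s] at [y]. *)
have [s su] := tu _ e40; have [d d0 sd] := act_mdist_continuous s y e40.
have [|r ru] := tu (Num.min d (e / 4)); first by rewrite lt_min d0.
pose w := u (act r^-1%g y).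
have uw : u w = w by have := congr1 (fun f => f (act r^-1%g y)) uu.
have := ru (act r^-1%g y); rewrite actKV lt_min => /andP[yw1 yw2].
have := su y; rewrite metric_sym => us; have := su w; rewrite uw => sw.
have := sd _ yw1 => syw; rewrite metric_sym in yw2.
have := metric_triangle (u y) (act s y) y.
have := metric_triangle (act s y) (act s w) y.
have := metric_triangle (act s w) w y.
rewrite -/w in yw2 *; lra.
Qed.

Lemma strongly_rigidP : strongly_rigid F <->
  distal F /\
  forall e, 0 < e ->
    exists2 t : grp F, t <> 1%g & forall x, mdist (act t x) x < e.
Proof.
split=> [sF|[dF rec]].
  have [u mu] := exists_minimal_idempotent.
  have uid := strongly_rigid_minimal_id sF mu; rewrite uid in mu.
  split; first exact: minimal_id_distal.
  have [K [le [t [[_ lexx _ _] tnt tu]]]] := sF _ mu.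
  by move=> e /tu[k /(_ _ (lexx k)) te]; exists (t k) => //; exact: (tnt k).2.
rewrite /strongly_rigid /= => u /(distal_minimal_id dF) ->.
have /choice[t tP] (e : {posnum R}) :
    exists t : grp F, t <> 1%g /\ forall x, mdist (act t x) x < e%:num.
  by have [//|t] := rec e%:num; exists t.
exists {posnum R}, (fun a b => b%:num <= a%:num), t; split.
- split; first exact: (inhabits 1%:pos).
  + by move=> a.
  + by move=> a b c ab bc; exact: le_trans bc ab.
  + move=> a b; exists (Num.min a%:num b%:num)%:pos => /=.
    by rewrite !ge_min !lexx orbT.
- by move=> k; split => // _; exact: (tP k).1.
- move=> e e0; exists (PosNum e0) => k /= ke x.
  exact: lt_le_trans ((tP k).2 x) ke.
Qed.

(** * Equicontinuous flows *)

(** If [t x] and [t y] are both near the same point [z], apply [t^-1]. *)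
Lemma equicontinuous_distal : equicontinuous_flow F -> distal F.
Proof.
move=> eF x y xy [[z z'] [/= cl /= zz']]; rewrite -{z'}zz' in cl.
have D0 : 0 < mdist x y / 2 by rewrite divr_gt0 // mdist_gt0; exact/eqP.
have [U zU Ueq] := eF z _ D0.
have [_ [[t _ <-] [/= Utx Uty]]] :
    range (fun t : grp F => (act t x, act t y)) `&` (U `*` U) !=set0.
  by apply: cl; exists (U, U).
have := Ueq _ Utx t^-1%g; have := Ueq _ Uty t^-1%g; rewrite !actK => h1.
have := metric_triangle x (act t^-1%g z) y.
rewrite (metric_sym (act _ z) y); lra.
Qed.

(** Cover [X] by finitely many sets [U y] on which all the maps of the action
    vary by less than [e / 4].  There are finitely many ways to assign to each
    center [y] a member of the cover containing its image, so two distinct [s]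
    and [t] send each center [y] into a common [U z].  All elements of the group
    then keep [s y] and [t y] within [e / 2]; [s^-1] brings the first one back
    to [y]. *)
Lemma equicontinuous_recurrent e : equicontinuous_flow F -> 0 < e ->
  exists2 t : grp F, t <> 1%g & forall x, mdist (act t x) x < e.
Proof.
move=> eF e0; have e40 : 0 < e / 4 by rewrite divr_gt0.
pose U y :=
  interior [set x | forall t : grp F, mdist (act t x) (act t y) < e / 4].
have Uy y : U y y.
  by have [V yV VP] := eF y _ e40; apply: filterS yV => x Vx t; exact: VP.
have [x0 _] := phase_nonempty.
pose Xp : ptopologicalType :=
  HB.pack (Metric.sort X) (isPointed.Build (Metric.sort X) x0).
have := @phase_compact R F; rewrite (@compact_cover Xp) => cov.
have [||D _ Dcov] := cov X setT U.
- by move=> y _; exact: open_interior.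
- by move=> y _; exists y.
have {}Dcov x : {y : D | U (fsval y) x}.
  apply: cid; have [y yD Uyx] := Dcov x I.
  by exists [` yD ]%fset.
have [s [t [st ft]]] := pigeonhole
  (fun t : grp F => [ffun y : D => projT1 (Dcov (act t (fsval y)))])
  (@grp_infinite R F).
exists (s^-1 * t)%g.
  by move=> st1; apply: st; rewrite -[t](mulVKg s) st1 mulg1.
move=> x; case: (Dcov x) => y yx.
have sub z w : U z w -> forall t : grp F, mdist (act t w) (act t z) < e / 4.
  by move=> /interior_subset.
have := congr1 (fun f : {ffun D -> D} => f y) ft; rewrite !ffunE.
case: (Dcov (act s _)) => z sz; case: (Dcov (act t _)) => z' tz /= zz'.
rewrite -{z'}zz' in tz.
have := sub _ _ sz s^-1%g; rewrite actK => h1.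
have := sub _ _ tz s^-1%g; rewrite -actM => h2.
have := sub _ _ yx (s^-1 * t)%g => h3.
have := sub _ _ yx 1%g; rewrite !act1 metric_sym => h4.
have := metric_triangle (act (s^-1 * t)%g x) (act (s^-1 * t)%g (fsval y)) x.
have := metric_triangle (act (s^-1 * t)%g (fsval y)) (act s^-1%g (fsval z)) x.
have := metric_triangle (act s^-1%g (fsval z)) (fsval y) x.
rewrite (metric_sym _ (fsval y)); lra.
Qed.

Lemma equicontinuous_strongly_rigid : equicontinuous_flow F -> strongly_rigid F.
Proof.
move=> eF; apply/strongly_rigidP; split; first exact: equicontinuous_distal.
by move=> e e0; exact: equicontinuous_recurrent.
Qed.

(** The orbit of a pair is finite too, hence closed. *)
Lemma finite_orbits_distal :
  (forall x, finite_set (range (fun t : grp F => act t x))) -> distal F.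
Proof.
move=> fin x y xy [z [cl zz]]; apply: xy.
have : closed (range (fun t : grp F => (act t x, act t y))).
  have hXX : hausdorff_space (X * X)%type.
    by apply: hausdorff_prod; exact: metric_hausdorff.
  have /accessible_finite_set_closed := hausdorff_accessible hXX; apply.
  apply: sub_finite_set (finite_setX (fin x) (fin y)).
  by move=> _ [t _ <-]; split; exists t.
move=> /(_ _ cl)[t _ tz]; move: zz; rewrite -tz /= => /(congr1 (act t^-1%g)).
by rewrite !actK.
Qed.

End FlowTheory.

(** * Swapping the points of two-point blocks *)

Lemma injective_infinite (T : Type) (f : nat -> T) :
  injective f -> infinite_set [set: T].
Proof.
move=> finj Tfin; apply: infinite_nat; rewrite -(preimage_setT f).
by apply: finite_preimage => // k l _ _; exact: finj.
Qed.

(** Polynomials over [bool] serve as the finitely supported sequences in Z/2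
    with pointwise addition, written multiplicatively: the coefficient at [k]
    tells whether the [k]-th block is swapped. *)
Definition toggles : Type := {poly bool}.

HB.instance Definition _ := Choice.on toggles.
HB.instance Definition _ := @isGroup.Build toggles
  (0 : {poly bool}) (fun p => - (p : {poly bool}))
  (fun p q => (p : {poly bool}) + (q : {poly bool}))
  (@addrA _) (@add0r _) (@addr0 _) (@addNr _) (@addrN _).

Section BlockSpace.
Context {R : realType}.
Variable (small : pred nat).
Implicit Types x y z : option nat * bool.

(** The points [(Some k, b)] form the [k]-th block, and the [(None, b)] are the
    two limit points.  The radius will be the distance from [x] to the limit
    point on its side. *)
Definition radius x : R := if x.1 is Some k then k.+1%:R^-1 else 0.

(** The limit point near which [x] lies.  Both points of a small block lie near
    [(None, false)]; those of any other block lie near different limit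
    points. *)
Definition limit_side x : bool :=
  if x.1 is Some k then x.2 && ~~ small k else x.2.

(** A path between distinct points passes through the limit points on their
    sides; the two limit points are at distance 1 from each other. *)
Definition block_dist x y : R :=
  if x == y then 0 else radius x + radius y + (limit_side x != limit_side y)%:R.

Lemma radius_ge0 x : 0 <= radius x.
Proof. by case: x => [[k|] b]; rewrite /radius //= invr_ge0. Qed.

Lemma radius_eq0 x : radius x = 0 -> x.1 = None.
Proof.
by case: x => [[k|] b] //= /eqP; rewrite /radius /= invr_eq0 pnatr_eq0.
Qed.

Lemma block_distxx x : block_dist x x = 0.
Proof. by rewrite /block_dist eqxx. Qed.

Lemma block_dist_sym x y : block_dist x y = block_dist y x.
Proof.
by rewrite /block_dist eq_sym (addrC (radius x)) (eq_sym (limit_side x)).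
Qed.

Lemma block_dist_eq0 x y : block_dist x y = 0 -> x = y.
Proof.
rewrite /block_dist; case: eqP => // _ /eqP.
rewrite paddr_eq0 ?addr_ge0 ?radius_ge0 // paddr_eq0 ?radius_ge0 //.
move=> /andP[/andP[/eqP/radius_eq0 x0 /eqP/radius_eq0 y0]].
rewrite pnatr_eq0 eqb0 negbK /limit_side; move: x y x0 y0.
by move=> [a b] [c d] /= -> -> /= /eqP ->.
Qed.

Lemma block_dist_triangle y x z :
  block_dist x z <= block_dist x y + block_dist y z.
Proof.
rewrite /block_dist; have [->|xz] := eqVneq x z.
  by rewrite addr_ge0 //; case: eqP => // _; rewrite !addr_ge0 ?radius_ge0.
have [<-|xy] := eqVneq x y; first by rewrite add0r (negbTE xz).
have [->|yz] := eqVneq y z; first by rewrite addr0.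
have := radius_ge0 y.
have : ((limit_side x != limit_side z)%:R : R) <=
  (limit_side x != limit_side y)%:R + (limit_side y != limit_side z)%:R.
  by rewrite -natrD ler_nat; do 3 case: limit_side.
lra.
Qed.

End BlockSpace.

Definition block_space (R : realType) (small : pred nat) : Type :=
  (option nat * bool)%type.

HB.instance Definition _ (R : realType) (small : pred nat) :=
  Choice.on (block_space R small).
HB.instance Definition _ (R : realType) (small : pred nat) :=
  @isMetric.Build R (block_space R small) (block_dist small)
  (block_distxx small) (@block_dist_eq0 R small)
  (block_dist_sym small) (block_dist_triangle small).

Section BlockFlow.
Context {R : realType}.
Variable (small : pred nat).
Local Notation X := (block_space R small).
Implicit Types x y : X.

Lemma mdist_block x y :
  mdist x y =
    if x == y then 0
    else radius x + radius y
         + (limit_side small x != limit_side small y)%:R :> R.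
Proof. by []. Qed.

Lemma radius_lt_mdist x y : mdist x y < radius x -> y = x.
Proof.
rewrite mdist_block; have [//|_] := eqVneq x y.
by rewrite -addrA gtrDl ltNge addr_ge0 // radius_ge0.
Qed.

Lemma mdist_limit x : mdist ((None, limit_side small x) : X) x <= radius x.
Proof.
rewrite mdist_block; case: ifP => _; first exact: radius_ge0.
by rewrite /= eqxx /= addr0 [radius _]/(0 : R) add0r.
Qed.

Lemma exists_radius_lt (e : R) : 0 < e ->
  exists N, forall k b, (N <= k)%N -> radius ((Some k, b) : X) < e.
Proof.
move=> e0; have [N _ NP] := near_infty_natSinv_lt (PosNum e0).
by exists N => k b Nk; exact: NP.
Qed.

(** All but finitely many points are close to one of the two limit points. *)
Lemma block_compact : compact [set: X].
Proof.
move=> G PG _; apply: contrapT => ncl.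
have /choice[A AP] x : exists A : set X, G A /\
    exists2 e : R, 0 < e & forall y, mdist x y < e -> ~ A y.
  apply: contrapT => nA; apply: ncl; exists x; split => // A U GA.
  move=> /nbhs_ballP[e /= e0 eU]; apply: contrapT => AU; apply: nA.
  exists A; split=> //; exists e => // y xy Ay; apply: AU; exists y; split=> //.
  by apply: eU; rewrite ballEmdist.
have GA x : G (A x) by have [] := AP x.
have [_ [e e0 eP]] := AP (None, false); have [_ [f f0 fP]] := AP (None, true).
have [|N NP] := @exists_radius_lt (Num.min e f); first by rewrite lt_min e0.
have : G (A (None, false) `&` A (None, true) `&`
    [set y | forall i : 'I_N * bool, A (Some (val i.1), i.2) y]).
  apply: filterI; first exact: filterI.
  by apply: filter_forall => i; exact: GA.
move=> /filter_ex[y [[Ay0 Ay1] Ay]].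
have [yr|yr] := ltP (radius y) (Num.min e f).
  move: yr; rewrite lt_min => /andP[ye yf].
  have := mdist_limit y; case: limit_side => yl.
    exact: fP (le_lt_trans yl yf) Ay1.
  exact: eP (le_lt_trans yl ye) Ay0.
case: y => [[k|] b] in yr Ay0 Ay1 Ay *; last first.
  by move: yr; rewrite [radius _]/(0 : R) leNgt lt_min e0 f0.
have [Nk|kN] := leqP N k; first by have := NP k b Nk; rewrite ltNge yr.
have [_ [g g0 gP]] := AP (Some k, b).
by apply: (gP (Some k, b)) (Ay (Ordinal kN, b)); rewrite mdistxx.
Qed.

Lemma block_infinite : infinite_set [set: X].
Proof.
apply: (@injective_infinite _ (fun k : nat => (Some k, false) : X)).
by move=> k l [].
Qed.

Lemma toggles_infinite : infinite_set [set: toggles].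
Proof.
apply: (@injective_infinite _ (fun k : nat => 'X^k : {poly bool})) => k l.
move=> /(congr1 (fun p : {poly bool} => size p)).
by rewrite !size_polyXn => -[].
Qed.

Definition toggle (t : toggles) x : X :=
  (x.1, if x.1 is Some k then x.2 (+) (t : {poly bool})`_k else x.2).

Lemma toggle1 x : toggle 1%g x = x.
Proof. by case: x => [[k|] b] //; rewrite /toggle /= coef0 addbF. Qed.

Lemma toggleM s t x : toggle (s * t)%g x = toggle s (toggle t x).
Proof.
case: x => [[k|] b] //; rewrite /toggle /= coefD -addbA.
by congr (_, _ (+) _); exact: addbC.
Qed.

(** The points [(Some k, b)] are isolated, and every [t] is the identity near
    the limit points. *)
Lemma toggle_continuous t : continuous (toggle t).
Proof.
move=> x U /nbhs_ballP[e /= e0 eU]; apply/nbhs_ballP.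
have [d d0 dP] : exists2 d : R, 0 < d & forall y, mdist x y < d ->
    mdist (toggle t x) (toggle t y) < e.
  case: x {eU} => [[k|] b].
    exists (radius ((Some k, b) : X)); first by rewrite /radius /= invr_gt0.
    by move=> y /radius_lt_mdist ->; rewrite mdistxx.
  (* Within [N.+1^-1] of a limit point, only blocks beyond the support of [t]
     occur. *)
  pose N := size (t : {poly bool}).
  exists (Num.min e (N.+1%:R^-1)); first by rewrite lt_min e0 invr_gt0 ltr0n.
  move=> y; rewrite lt_min => /andP[ye yN].
  suff -> : toggle t y = y by [].
  case: y => [[k|] c] in ye yN *; rewrite /toggle //=.
  rewrite nth_default ?addbF //.
  move: yN; rewrite mdist_block /= [radius (None, b)]/(0 : R) add0r.
  rewrite leqNgt => yN; apply/negP => kN; move: yN.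
  rewrite ltNge => /negP; apply; rewrite -[leLHS]addr0 lerD //.
  by rewrite lef_pV2 ?posrE ?ltr0n // ler_nat ltnS ltnW.
exists d => // y; rewrite /= ballEmdist /= => /dP ye.
by apply: eU; rewrite ballEmdist.
Qed.

Definition toggle_flow : flow R :=
  Flow block_compact block_infinite toggles_infinite toggle1 toggleM
    toggle_continuous.

Lemma toggle_effective : effective toggle_flow.
Proof.
move=> t tid; apply/polyP => k; rewrite coef0.
by have /(congr1 snd) := tid (Some k, false).
Qed.

Lemma toggle_distal : distal toggle_flow.
Proof.
apply: finite_orbits_distal => x.
apply: (@sub_finite_set _ _ ([set x.1] `*` [set: bool])).
  by move=> _ [t _ <-]; split.
by apply: finite_setX => //; exact: finite_finset.
Qed.

(** The diameter of the [k]-th block: over the small blocks it tends to 0, and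
    otherwise it is at least 1. *)
Lemma mdist_flip k : mdist ((Some k, true) : X) (Some k, false) =
  2 * k.+1%:R^-1 + (~~ small k)%:R :> R.
Proof.
rewrite mdist_block xpair_eqE eqxx /radius /= mulr_natl mulr2n.
by rewrite /limit_side /=; case: (small k).
Qed.

Lemma toggle_Xn_dist k x :
  mdist (toggle ('X^k : {poly bool}) x) x <=
    2 * k.+1%:R^-1 + (~~ small k)%:R :> R.
Proof.
have c0 : 0 <= 2 * k.+1%:R^-1 + (~~ small k)%:R :> R.
  by rewrite addr_ge0 // mulr_ge0 // invr_ge0.
case: x => [[l|] b]; last by rewrite /toggle mdistxx.
rewrite /toggle /= coefXn; have [->|_] := eqVneq l k; last first.
  by rewrite addbF mdistxx.
by rewrite -mdist_flip; case: b => //; rewrite metric_sym.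
Qed.

Lemma toggle_recurrent : (forall n, exists2 k, (n <= k)%N & small k) ->
  forall e : R, 0 < e -> exists2 t : toggles, t <> 1%g &
    forall x, mdist (toggle t x) x < e.
Proof.
move=> inf e e0; have e20 : 0 < e / 2 by rewrite divr_gt0.
have [N NP] := exists_radius_lt e20; have [k Nk sk] := inf N.
exists ('X^k : {poly bool}).
  by move=> /(congr1 (fun p : {poly bool} => p`_k)); rewrite coefXn coef0 eqxx.
move=> x; apply: le_lt_trans (toggle_Xn_dist k x) _.
by have := NP k false Nk; rewrite /radius /= sk addr0 ltr_pdivlMr // mulrC.
Qed.

Lemma toggle_not_equicontinuous :
  (forall n, exists2 k, (n <= k)%N & ~~ small k) ->
  ~ equicontinuous_flow toggle_flow.
Proof.
move=> inf /(_ (None, false) 1 ltr01)[U /nbhs_ballP[e /= e0 eU] UP].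
have [N NP] := exists_radius_lt e0; have [k Nk sk] := inf N.
have kU : U (Some k, false).
  apply: eU; rewrite ballEmdist /=; apply: le_lt_trans (NP k false Nk).
  exact: (mdist_limit ((Some k, false) : X)).
have := UP _ kU ('X^k : {poly bool}).
rewrite /= /toggle /= coefXn eqxx /= mdist_block /limit_side /= sk /=.
by rewrite ltNge lerDr addr_ge0 ?radius_ge0.
Qed.

Lemma toggle_not_strongly_rigid : (forall k, ~~ small k) ->
  ~ strongly_rigid toggle_flow.
Proof.
move=> big /strongly_rigidP[_ /(_ 1 ltr01)[t t1 tP]]; apply: t1.
apply/polyP => k; rewrite coef0; apply/negbTE/negP => tk.
have := tP (Some k, false); rewrite /= /toggle /= tk mdist_flip big.
by rewrite ltNge lerDr mulr_ge0 // invr_ge0.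
Qed.

End BlockFlow.

Theorem mainTheorem1 (R : realType) :
  [/\ forall F : flow R, equicontinuous_flow F -> strongly_rigid F,
      forall F : flow R, strongly_rigid F -> distal F,
      exists F : flow R,
        [/\ effective F, strongly_rigid F & ~ equicontinuous_flow F] &
      exists F : flow R,
        [/\ effective F, distal F & ~ strongly_rigid F]].
Proof.
split.
- by move=> F; exact: equicontinuous_strongly_rigid.
- by move=> F /strongly_rigidP[].
- exists (@toggle_flow R odd); split; first exact: toggle_effective.
    apply/strongly_rigidP; split; first exact: toggle_distal.
    by apply: toggle_recurrent => n; exists n.*2.+1;
      rewrite /= ?odd_double //; lia.
  apply: toggle_not_equicontinuous => n.
  by exists n.*2; rewrite ?odd_double //; lia.
- exists (@toggle_flow R pred0); split; first exact: toggle_effective.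
    exact: toggle_distal.
  exact: toggle_not_strongly_rigid.
Qed.
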